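(* Let $w_1,w_2\in(0,1)$ and let $f,g\colon[0,1]\to[-\infty,\infty]$ be strictly monotone continuous functions. If $\min\{|f(0)|,|g(0)|\}=\infty$ or $\min\{|f(1)|,|g(1)|\}=\infty$, then the pair $(\mathrm{K}_{w_1}^{f},\mathrm{K}_{w_2}^{g})$ of quasi-linear means generated by $f$ and $g$ is not admissible.
   Context: Let $\mathsf{Int}_{[0,1]}=\{[a_1,a_2]: 0\le a_1\le a_2\le 1\}$ (degenerate intervals allowed); write $\mathbf u=[u_1,u_2]$. The interval order is: $\mathbf u\preceq_{\mathrm{Int}}\mathbf x$ iff $u_1\le x_1$ and $u_2\le x_2$. An admissible order is a total order $\preceq$ on $\mathsf{Int}_{[0,1]}$ such that $\mathbf u\preceq_{\mathrm{Int}}\mathbf x$ implies $\mathbf u\preceq\mathbf x$. An aggregation function (AF) is a function $\mathrm A\colon\mathsf{Int}_{[0,1]}\to[0,1]$ with $\mathrm A([0,0])=0$, $\mathrm A([1,1])=1$, and $\mathrm A(\mathbf u)\le\mathrm A(\mathbf x)$ whenever $u_1\le x_1$ and $u_2\le x_2$. For a pair $(\mathrm A,\mathrm B)$ of AFs, the relation $\preceq_{\mathrm A,\mathrm B}$ is defined by: $\mathbf u\preceq_{\mathrm A,\mathrm B}\mathbf x$ iff $\mathrm A(\mathbf u)<\mathrm A(\mathbf x)$, or $\mathrm A(\mathbf u)=\mathrm A(\mathbf x)$ and $\mathrm B(\mathbf u)\le\mathrm B(\mathbf x)$. The pair $(\mathrm A,\mathrm B)$ is admissible if $\preceq_{\mathrm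 A,\mathrm B}$ is an admissible order. For $w\in(0,1)$ and a strictly monotone continuous $f\colon[0,1]\to[-\infty,\infty]$, the quasi-linear mean generated by $f$ is $\mathrm K_w^f\colon\mathsf{Int}_{[0,1]}\to[0,1]$, $\mathrm K_w^f([z_1,z_2])=f^{-1}\big((1-w)f(z_1)+wf(z_2)\big)$, with the convention $-\infty+\infty=\infty-\infty=-\infty$, where $f^{-1}$ is the inverse of $f$ on its range $\operatorname{Ran}(f)$. *)

(* Defs.v *)
From HB Require Import structures.
From mathcomp Require Import all_boot all_order all_algebra.
From mathcomp Require Import all_classical all_reals all_analysis.

Set Implicit Arguments.
Unset Strict Implicit.
Unset Printing Implicit Defensive.

Import Order.TTheory GRing.Theory Num.Theory.
Import numFieldNormedType.Exports.

Local Open Scope classical_set_scope.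
Local Open Scope ring_scope.

(* The defining condition is boolean, so equality of intervals is equality of
   their endpoints. *)
Definition Int01 (R : realType) : Type :=
  {z : R * R | [&& 0 <= z.1, z.1 <= z.2 & z.2 <= 1]}.

Definition lo (R : realType) (u : Int01 R) : R := (val u).1.
Definition hi (R : realType) (u : Int01 R) : R := (val u).2.

Definition le_Int (R : realType) : rel (Int01 R) :=
  fun u x => (lo u <= lo x) && (hi u <= hi x).

Definition admissible_order (R : realType) (le : rel (Int01 R)) : Prop :=
  [/\ reflexive le, antisymmetric le, transitive le, total le
    & forall u x : Int01 R, le_Int u x -> le u x].

Definition le_pair (R : realType) (A B : Int01 R -> R) : rel (Int01 R) :=
  fun u x => (A u < A x) || ((A u == A x) && (B u <= B x)).

(* Stated for arbitrary real functions of intervals; aggregation functions are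
   the case of interest, and quasi-linear means are aggregation functions. *)
Definition admissible_pair (R : realType) (A B : Int01 R -> R) : Prop :=
  admissible_order (le_pair A B).

(* A function [0, 1] -> [-oo, +oo] is represented by a total function
   R -> \bar R of which only the values on [0, 1] are ever used. *)
Definition strictly_monotone01 (R : realType) (f : R -> \bar R) : Prop :=
  (forall x y : R, x \in `[0, 1] -> y \in `[0, 1] ->
     x < y -> (f x < f y)%E) \/
  (forall x y : R, x \in `[0, 1] -> y \in `[0, 1] ->
     x < y -> (f y < f x)%E).

(* The addition of \bar R satisfies -oo + +oo = +oo + -oo = -oo.  The default
   value 0 of the inverse is only taken outside of the range of f on [0, 1],
   which contains the weighted sum when f is continuous and strictly monotone
   on [0, 1] and 0 < w < 1. *)
Definition quasi_linear_mean (R : realType) (w : R) (f : R -> \bar R)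
    (z : Int01 R) : R :=
  'pinv_(fun=> 0) `[0, 1] f
    ((1 - w)%:E * f (lo z) + w%:E * f (hi z))%E.

(* Main.v *)
(* If f and g are both infinite at 0, then both means send every [0, x] with
   0 < x < 1 to 0, because f x and g x are finite; if both are infinite at 1,
   they send every [x, 1] to 1. Either way two distinct intervals have the same
   pair of values, which contradicts antisymmetry. *)
Require Import Defs.
From HB Require Import structures.
From mathcomp Require Import all_boot all_order all_algebra.
From mathcomp Require Import all_classical all_reals all_analysis.
From mathcomp Require Import lra.

Import Order.TTheory GRing.Theory Num.Theory.
Import numFieldNormedType.Exports.

Local Open Scope classical_set_scope.
Local Open Scope ring_scope.

Section InfiniteEndpoint.
Variables (R : realType) (f : R -> \bar R).
Hypothesis f_mono : strictly_monotone01 f.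

Lemma strictly_monotone01_inj : {in `[0, 1] &, injective f}.
Proof.
move=> x y x01 y01 fxy.
case: f_mono => fm; case: (ltgtP x y) => // xy.
- by have := fm _ _ x01 y01 xy; rewrite fxy ltxx.
- by have := fm _ _ y01 x01 xy; rewrite fxy ltxx.
- by have := fm _ _ x01 y01 xy; rewrite fxy ltxx.
- by have := fm _ _ y01 x01 xy; rewrite fxy ltxx.
Qed.

(** By strict monotonicity [f x] lies strictly between [f 0] and [f 1], hence strictly between the
    two infinities. *)
Lemma strictly_monotone01_fin_num (x : R) : 0 < x < 1 -> f x \is a fin_num.
Proof.
move=> /andP[x0 x1].
have i0 : 0 \in `[(0 : R), 1] by rewrite in_itv/= lexx ler01.
have i1 : 1 \in `[(0 : R), 1] by rewrite in_itv/= lexx ler01.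
have ix : x \in `[(0 : R), 1] by rewrite in_itv/= !ltW.
rewrite fin_numElt; case: f_mono => fm.
  by rewrite (le_lt_trans (leNye _) (fm _ _ i0 ix x0))
             (lt_le_trans (fm _ _ ix i1 x1) (leey _)).
by rewrite (le_lt_trans (leNye _) (fm _ _ ix i1 x1))
           (lt_le_trans (fm _ _ i0 ix x0) (leey _)).
Qed.

(** The argument [f x] is in the image of [[0, 1]], so the default value 0 of the inverse does not
    enter; injectivity makes the preimage unique. *)
Lemma pinv_strictly_monotone01 (x : R) :
  x \in `[0, 1] -> 'pinv_(fun=> 0) `[0, 1] f (f x) = x.
Proof.
move=> x01; apply: pinvKV; last by rewrite inE.
by move=> a b; rewrite !inE; exact: strictly_monotone01_inj.
Qed.

(** A positive factor keeps an infinite value and its sign, and the other term is finite, so it is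
    absorbed; opposite infinities never meet. *)
Lemma adde_infty_fin_num (p q : R) (a b : \bar R) :
  0 < p -> `|a|%E = +oo%E -> b \is a fin_num ->
  (p%:E * a + q%:E * b)%E = a.
Proof.
move=> p0; case: a => // _; case: b => // b _.
- by rewrite gt0_muley ?lte_fin// -EFinM addye.
- by rewrite gt0_muleNy ?lte_fin// -EFinM addNye.
Qed.

(** The weight [1 - w] of [f 0] is positive, so the weighted sum collapses to [f 0]. *)
Lemma quasi_linear_mean_lo0 (w : R) (u : Int01 R) :
  w < 1 -> `|f 0|%E = +oo%E -> lo u = 0 -> 0 < hi u < 1 ->
  quasi_linear_mean w f u = 0.
Proof.
move=> w1 f0 lou hiu; rewrite /quasi_linear_mean lou adde_infty_fin_num//.
- by rewrite pinv_strictly_monotone01// in_itv/= lexx ler01.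
- by rewrite subr_gt0.
- exact: strictly_monotone01_fin_num.
Qed.

Lemma quasi_linear_mean_hi1 (w : R) (u : Int01 R) :
  0 < w -> `|f 1|%E = +oo%E -> hi u = 1 -> 0 < lo u < 1 ->
  quasi_linear_mean w f u = 1.
Proof.
move=> w0 f1 hiu lou.
(* Here the infinite term is the second one, with weight [w]; commuting the sum brings it to the
   front. *)
rewrite /quasi_linear_mean hiu addeC adde_infty_fin_num//.
- by rewrite pinv_strictly_monotone01// in_itv/= lexx ler01.
- exact: strictly_monotone01_fin_num.
Qed.

End InfiniteEndpoint.

Lemma Int01_exists (R : realType) (x y : R) :
  0 <= x -> x <= y -> y <= 1 -> exists u : Int01 R, lo u = x /\ hi u = y.
Proof.
move=> x0 xy y1.
have xyP : [&& 0 <= (x, y).1, (x, y).1 <= (x, y).2 & (x, y).2 <= 1].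
  by rewrite /= x0 xy y1.
by exists (exist _ (x, y) xyP).
Qed.

(** Intervals on which both functions agree are below each other in [le_pair], so antisymmetry
    identifies them. *)
Lemma admissible_pair_inj (R : realType) (A B : Int01 R -> R) (u v : Int01 R) :
  admissible_pair A B -> A u = A v -> B u = B v -> u = v.
Proof.
move=> [_ anti _ _ _] Auv Buv.
by apply: anti; rewrite /Defs.le_pair Auv Buv !eqxx !lexx !orbT.
Qed.

Lemma mine_eqy (R : realType) (a b : \bar R) :
  mine a b = +oo%E -> a = +oo%E /\ b = +oo%E.
Proof.
move=> ab; split; apply/eqP; rewrite -leye_eq -ab ge_min lexx ?orbT//.
Qed.

Theorem theorem4p1 (R : realType) (w1 w2 : R) (f g : R -> \bar R)
    (hw1 : 0 < w1 < 1) (hw2 : 0 < w2 < 1)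
    (f_mono : strictly_monotone01 f) (g_mono : strictly_monotone01 g)
    (f_cont : {within `[0, 1], continuous f})
    (g_cont : {within `[0, 1], continuous g})
    (hinf : mine `|f 0%R|%E `|g 0%R|%E = +oo%E \/
            mine `|f 1%R|%E `|g 1%R|%E = +oo%E) :
  ~ admissible_pair (quasi_linear_mean w1 f) (quasi_linear_mean w2 g).
Proof.
have [/andP[w1_gt0 w1_lt1] /andP[w2_gt0 w2_lt1]] := (hw1, hw2).
(* Any two distinct points of the open unit interval would serve as [a] and [b]. *)
move=> adm; pose a : R := 3^-1; pose b : R := 2^-1.
have a01 : 0 < a < 1 by rewrite /a; lra.
have b01 : 0 < b < 1 by rewrite /b; lra.
have ab : a <> b by rewrite /a /b; lra.
case: hinf => /mine_eqy[f_infty g_infty].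
- have [u [lou hiu]] : exists u : Int01 R, lo u = 0 /\ hi u = a.
    by apply: Int01_exists; case/andP: a01 => /ltW ? /ltW ?; rewrite ?lexx.
  have [v [lov hiv]] : exists v : Int01 R, lo v = 0 /\ hi v = b.
    by apply: Int01_exists; case/andP: b01 => /ltW ? /ltW ?; rewrite ?lexx.
  (* Both means are 0 on [[0, a]] and on [[0, b]]; identifying these intervals would force
     [a = b]. *)
  apply: ab; rewrite -hiu -hiv; congr hi.
  by apply: (admissible_pair_inj _ _ _ _ _ adm); rewrite !quasi_linear_mean_lo0 ?hiu ?hiv.
- have [u [lou hiu]] : exists u : Int01 R, lo u = a /\ hi u = 1.
    by apply: Int01_exists; case/andP: a01 => /ltW ? /ltW ?; rewrite ?lexx.
  have [v [lov hiv]] : exists v : Int01 R, lo v = b /\ hi v = 1.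
    by apply: Int01_exists; case/andP: b01 => /ltW ? /ltW ?; rewrite ?lexx.
  apply: ab; rewrite -lou -lov; congr lo.
  by apply: (admissible_pair_inj _ _ _ _ _ adm); rewrite !quasi_linear_mean_hi1 ?lou ?lov.
Qed.
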